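(* Let $c$ be a symmetric two-colouring of pairs with Erdős–Rado order $\prec$, and let $T'$, $T^\beta$, ${\sf Depth}$ be as in the context. Let $\beta\colon\mathbb{N}\to\mathbb{N}$ satisfy \[ \forall n,k\ \forall s\in\mathbb{B}^n\ (T'(s,k)\to T'(s,\beta n)), \] and let $\omega\colon\mathbb{B}^{\mathbb{N}}\to\mathbb{N}$ be given. Define $q^\omega\colon\mathbb{B}^{\mathbb{N}}\to\mathbb{N}$ by $q^\omega\alpha=\omega\alpha-k-1$, where $k<\omega\alpha$ is the least number for which \[ {\sf Depth}_{\omega\alpha-k}(T^\beta_{\overline{\alpha}k})\to{\sf Depth}_{\omega\alpha-k-1}(T^\beta_{\overline{\alpha}(k+1)}) \] fails, and $q^\omega\alpha=0$ if no such $k$ exists. Define selection functions $\varepsilon_s\colon(\mathbb{B}\to\mathbb{N})\to\mathbb{B}$ for $s\in\mathbb{B}^*$ by $\varepsilon_s p=0$ if ${\sf Depth}_{p(0)+1}(T^\beta_s)\to{\sf Depth}_{p(0)}(T^\beta_{s*\langle 0\rangle})$ holds, and $\varepsilon_s p=1$ otherwise. Then the sequence $\alpha={\sf EPS}^{\omega}_{\langle\rangle}(\varepsilon)(q^\omega)$ satisfies $T^\beta(\overline{\alpha}(\omega\alpha))$.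
   Context: $\mathbb{B}=\{0,1\}$; $c\colon\mathbb{N}^2\to\mathbb{B}$ with $c(i,j)=c(j,i)$. The Erdős–Rado order $\prec$: $0\prec1$, and, given $\prec$ already defined on $\{0,\dots,j\}$, for $j<i$ set $j\prec i$ iff $c(k,i)=c(k,j)$ for all $k\prec j$. For a finite binary sequence $s$ of length $|s|$ with entries $s_0,\dots,s_{|s|-1}$ and $k\in\mathbb{N}$: $T'(s,k):\equiv\exists k'\in[|s|,k]\ \forall i<|s|\,(s_i=0\leftrightarrow i\prec k')$; for $\beta\colon\mathbb{N}\to\mathbb{N}$, $T^\beta(s):\equiv T'(s,\beta(|s|))$. For $s\in\mathbb{B}^*$, $T^\beta_s$ is the tree of extensions $t\mapsto T^\beta(s*t)$, and ${\sf Depth}_n(T^\beta_s):\equiv\exists t\in\mathbb{B}^n\,T^\beta(s*t)$. $\overline{\alpha}n=\langle\alpha0,\dots,\alpha(n-1)\rangle$; $*$ is concatenation. Product of selection functions: given sets $X,R$, a family $(\varepsilon_s)_{s\in X^*}$ of maps $\varepsilon_s\colon(X\to R)\to X$, a control $\omega\colon X^{\mathbb{N}}\to\mathbb{N}$ and $q\colon X^{\mathbb{N}}\to R$, define ${\sf EPS}^\omega_s(\varepsilon)(q)\in X^{\mathbb{N}}$ for $s\in X^*$ by: it equals the constant-zero sequence if $\omega(s*{\bf 0})<|s|$, and otherwise equals $a_s*{\sf EPS}^\omega_{s*\langle a_s\rangle}(\varepsilon)(q_{a_s})$, where $a_s=\varepsilon_s\bigl(\lambda x.\,q_x({\sf EPS}^\omega_{s*\langle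 x\rangle}(\varepsilon)(q_x))\bigr)$ and $q_x(\gamma)=q(x*\gamma)$. All functionals are understood as continuous (as in the paper's model of total continuous/bar-recursive functionals), which makes this recursion well-founded. *)

(* Defs.v *)
From HB Require Import structures.
From mathcomp Require Import all_boot.
From mathcomp Require Import boolp classical_sets topology.

Set Implicit Arguments.
Unset Strict Implicit.
Unset Printing Implicit Defensive.

Local Open Scope nat_scope.

(* The truth values 0 and 1 of a colour or of an entry of a binary sequence
   are [false] and [true]. *)

Section ErdosRado.
Variable c : nat -> nat -> bool.

(* Whether j precedes i depends only on the order below j, so j.+1 units of
   fuel suffice; [ERltE] is the defining equation of the order. *)
Fixpoint ERlt_rec (n j i : nat) : bool :=
  if n is n'.+1 then
    (j < i) && [forall k : 'I_j, ERlt_rec n' k j ==> (c k i == c k j)]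
  else false.

Definition ERlt (j i : nat) : bool := ERlt_rec j.+1 j i.

Lemma ERlt_rec_stable n m j i :
  j < n -> j < m -> ERlt_rec n j i = ERlt_rec m j i.
Proof.
elim: n m j i => // n IHn [//|m] j i jn jm /=; congr (_ && _).
apply: eq_forallb => k; congr (_ ==> _).
by apply: IHn; apply: leq_trans (ltn_ord k) _; rewrite -ltnS.
Qed.

Lemma ERltE j i :
  ERlt j i = (j < i) && [forall k : 'I_j, ERlt k j ==> (c k i == c k j)].
Proof.
rewrite {1}/ERlt [LHS]/=; congr (_ && _); apply: eq_forallb => k.
by congr (_ ==> _); apply: ERlt_rec_stable.
Qed.

Lemma ERlt01 : ERlt 0 1.
Proof. by rewrite ERltE; apply/forallP => -[]. Qed.

(* T'(s,k) *)
Definition ERbranch (s : seq bool) (k : nat) : bool :=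
  [exists k' : 'I_k.+1, (size s <= k') &&
     [forall i : 'I_(size s), (nth false s i == false) == ERlt i k']].

(* T^beta *)
Definition ERtree (beta : nat -> nat) (s : seq bool) : bool :=
  ERbranch s (beta (size s)).

End ErdosRado.

(* T_s *)
Definition subtree (T : pred (seq bool)) (s : seq bool) : pred (seq bool) :=
  fun t => T (s ++ t).

Definition Depth (n : nat) (T : pred (seq bool)) : bool :=
  [exists t : n.-tuple bool, T t].

Section BarRecursion.
Variable X : Type.

Definition scons (x : X) (a : nat -> X) : nat -> X :=
  fun n => if n is m.+1 then a m else x.

(* s * a for a finite sequence s and an infinite sequence a *)
Definition scat (s : seq X) (a : nat -> X) : nat -> X := foldr scons a s.

Lemma scat_lt x0 s a n : n < size s -> scat s a n = nth x0 s n.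
Proof. by elim: s n => [//|x s IHs] [|n] //= /IHs. Qed.

End BarRecursion.

Section EPS.
Variables (X : discreteTopologicalType) (x0 : X) (R : Type).
Variable omega : {ptws nat -> X} -> nat.

(* EPS at s calls itself at s * <x> only when omega (s * 0) >= |s|. As X is
   discrete, continuity of omega for the product topology on {ptws nat -> X}
   means that omega a depends on a finite initial segment of a only. *)
Inductive EPS_call : seq X -> seq X -> Prop :=
  EPSCall s x of size s <= omega (scat s (fun=> x0)) : EPS_call (rcons s x) s.

Lemma EPS_call_wf : continuous omega -> well_founded EPS_call.
Proof.
move=> comega s0; apply: contrapT => nAcc0.
have nextP s : ~ Acc EPS_call s ->
    exists x, size s <= omega (scat s (fun=> x0)) /\ ~ Acc EPS_call (rcons s x).
  move=> nAcc; apply: contrapT => nx; apply: nAcc; constructor=> t ts.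
  have [x [-> le_s]] : exists x,
      t = rcons s x /\ size s <= omega (scat s (fun=> x0)).
    by case: ts => s' x le_s; exists x.
  by apply: contrapT => nAcc; apply: nx; exists x.
have /choice[next nextQ] s : exists x, ~ Acc EPS_call s ->
    size s <= omega (scat s (fun=> x0)) /\ ~ Acc EPS_call (rcons s x).
  by have [?|/nextP[x ?]] := EM (Acc EPS_call s); [exists x0 | exists x].
pose p n := iter n (fun s => rcons s (next s)) s0.
have nAccp n : ~ Acc EPS_call (p n).
  by elim: n => // n /nextQ[].
have sizep n : size (p n) = n + size s0.
  by elim: n => // n IHn; rewrite /p iterS size_rcons -/(p n) IHn.
pose a : {ptws nat -> X} := fun n => nth x0 (p n.+1) n.
have pa m n i : m <= n -> i < size (p m) -> nth x0 (p n) i = nth x0 (p m) i.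
  move=> /subnK <-; elim: (n - m) => // d IHd im.
  rewrite -[RHS]IHd // addSn [p _.+1]iterS -/(p (d + m)) nth_rcons.
  by rewrite (leq_trans im) // !sizep leq_add2r leq_addl.
pose u n : {ptws nat -> X} := scat (p n) (fun=> x0).
have ua : (u n @[n --> \oo] --> a)%classic.
  apply/cvg_sup => i U [V [[W oW <-] Wai] WU].
  apply: (filterS WU); rewrite nbhs_simpl; exists i.+1 => // n /= lt_in.
  have ip : i < size (p i.+1) by rewrite sizep ltn_addr.
  rewrite /u (scat_lt x0); last by rewrite sizep ltn_addr // ltnW.
  by rewrite (pa i.+1).
have [N _ omegaN] : (\forall n \near \oo, omega (u n) = omega a)%classic.
  exact: (cvg_comp _ _ ua (comega a) _ (discrete_set1 (omega a))).
pose n := maxn N (omega a).+1.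
have [] := nextQ _ (nAccp n); rewrite -/(u n) omegaN /= ?leq_maxl // sizep.
by rewrite leqNgt ltn_addr // leq_maxr.
Qed.

Variable eps : seq X -> (X -> R) -> X.

(* The equality test yields the evidence that the recursive calls at s are
   allowed; [EPSE] is the resulting equation without it. *)
Definition EPS_step (s : seq X)
    (rec : forall t, EPS_call t s -> ((nat -> X) -> R) -> nat -> X)
    (q : (nat -> X) -> R) : nat -> X :=
  if (size s <= omega (scat s (fun=> x0))) =P true is ReflectT le_s then
    let b x := rec (rcons s x) (EPSCall x le_s) (fun a => q (scons x a)) in
    let a_s := eps s (fun x => q (scons x (b x))) in
    scons a_s (b a_s)
  else fun=> x0.

Definition EPS (comega : continuous omega) (s : seq X) (q : (nat -> X) -> R) :
    nat -> X :=
  Fix (EPS_call_wf comega) (fun=> ((nat -> X) -> R) -> nat -> X) EPS_step s q.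

Lemma EPSE (comega : continuous omega) s q :
  EPS comega s q =
  if omega (scat s (fun=> x0)) < size s then fun=> x0 else
    let q_ x := fun a => q (scons x a) in
    let a_s := eps s (fun x => q_ x (EPS comega (rcons s x) (q_ x))) in
    scons a_s (EPS comega (rcons s a_s) (q_ a_s)).
Proof.
rewrite {1}/EPS Fix_eq => [|{}s f g fg].
  by rewrite {1}/EPS_step ltnNge; case: eqP => [->|/negP/negPf->].
suff -> : f = g by [].
by apply: functional_extensionality_dep => t; apply: functional_extensionality_dep.
Qed.

End EPS.

Section ERinstance.
Variables (c : nat -> nat -> bool) (beta : nat -> nat).

(* q^omega; [find] over 0, ..., m-1 returns the least index at which the
   implication fails, and m if there is none. *)
Definition q_omega (omega : (nat -> bool) -> nat) (a : nat -> bool) : nat :=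
  let m := omega a in
  let T k := subtree (ERtree c beta) (mkseq a k) in
  let fails k := ~~ (Depth (m - k) (T k) ==> Depth (m - k - 1) (T k.+1)) in
  let k := find fails (iota 0 m) in
  if k < m then m - k - 1 else 0.

Definition ERsel (s : seq bool) (p : bool -> nat) : bool :=
  let T s := subtree (ERtree c beta) s in
  if Depth (p false + 1) (T s) ==> Depth (p false) (T (rcons s false))
  then false else true.

End ERinstance.

(* Main.v *)
Require Import Defs.
From mathcomp Require Import all_boot.
From mathcomp Require Import boolp topology.

(** Spector's equations: at every stage [k <= omega alpha] the entry [alpha k]
    is chosen by the selection function against a function [p] with
    [p (alpha k) = q alpha].  For [q = q_omega], a least [k] at which the depth
    implication fails would give [p (alpha k) = omega alpha - k - 1], which
    contradicts the choice of [alpha k] because every node of depth [n.+1] has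
    a child of depth [n].  So the implication never fails, and the depth
    [omega alpha] of the root is carried down to depth 0 of the initial segment
    of [alpha] of length [omega alpha]. *)

Lemma scat_rcons (X : Type) (s : seq X) x a :
  scat (rcons s x) a = scat s (scons x a).
Proof. by elim: s => //= y s ->. Qed.

Section Spector.
Variables (X : discreteTopologicalType) (x0 : X) (R : Type).
Variables (omega : {ptws nat -> X} -> nat) (comega : continuous omega).
Variables (eps : seq X -> (X -> R) -> X) (q : (nat -> X) -> R).

Let after s b := q (scat s b).
Let a := EPS x0 eps comega [::] q.
(** The argument on which the recursion evaluates [eps s] at the node [s]. *)
Let p s x := after s (scons x (EPS x0 eps comega (rcons s x) (after (rcons s x)))).

Lemma EPS_unfold_along k : k <= omega a ->
    a = scat (mkseq a k) (EPS x0 eps comega (mkseq a k) (after (mkseq a k))) ->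
  a k = eps (mkseq a k) (p (mkseq a k)) /\
  a = scat (mkseq a k.+1)
        (EPS x0 eps comega (mkseq a k.+1) (after (mkseq a k.+1))).
Proof.
move=> le_k; have sz := size_mkseq a k.
rewrite mkseqS; set s := mkseq a k in sz *.
have after_rcons x : (fun b => after s (scons x b)) = after (rcons s x).
  by apply/funext => b; rewrite /after scat_rcons.
rewrite EPSE sz; case: ifPn => [lt_k a_eq|_].
  (* Had the recursion stopped at [s], then [a] would be [s] followed by the default [x0], and the
     stopping test would read [omega a < k]. *)
  by move: le_k; rewrite leqNgt a_eq lt_k.
rewrite /=; have -> : (fun x => after s (scons x (EPS x0 eps comega (rcons s x)
    (fun b => after s (scons x b))))) = p s.
  by apply/funext => x; rewrite after_rcons.
rewrite after_rcons => a_eq.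
have ak : a k = eps s (p s).
  rewrite a_eq -scat_rcons (scat_lt x0) ?size_rcons ?sz //.
  by rewrite nth_rcons sz ltnn eqxx.
by split=> //; rewrite ak scat_rcons.
Qed.

Lemma EPS_prefix k : k <= omega a ->
  a = scat (mkseq a k) (EPS x0 eps comega (mkseq a k) (after (mkseq a k))).
Proof.
elim: k => [|k IHk] le_k; first by [].
by have [] := EPS_unfold_along _ (ltnW le_k) (IHk (ltnW le_k)).
Qed.

Lemma EPS_spector k : k <= omega a ->
  exists2 f, a k = eps (mkseq a k) f & f (a k) = q a.
Proof.
move=> le_k; have [ak a_eq] := EPS_unfold_along _ le_k (EPS_prefix _ le_k).
exists (p (mkseq a k)) => //.
(* At [x = a k], the sequence that [p] passes to [q] is [a] itself. *)
by rewrite /p {1}/after -scat_rcons -mkseqS -a_eq.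
Qed.

End Spector.

Section Trees.

Lemma Depth0 T : Depth 0 T = T [::].
Proof.
by apply/existsP/idP => [[t]|T0]; [rewrite tuple0 | exists [tuple]].
Qed.

Lemma DepthP n (T : pred (seq bool)) :
  reflect (exists2 t, size t = n & T t) (Depth n T).
Proof.
apply: (iffP existsP) => [[t Tt]|[t /eqP sz Tt]]; last by exists (Tuple sz).
by exists t; rewrite ?size_tuple.
Qed.

Variable T : pred (seq bool).
Hypothesis T_prefix : forall s t, T (s ++ t) -> T s.

Lemma Depth_subtree_le s m n : m <= n ->
  Depth n (subtree T s) -> Depth m (subtree T s).
Proof.
move=> le_mn /DepthP[t szt Tt]; apply/DepthP; exists (take m t).
  by rewrite size_takel ?szt.
by apply: (T_prefix _ (drop m t)); rewrite -catA cat_take_drop.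
Qed.

Lemma Depth_subtreeS s n : Depth n.+1 (subtree T s) ->
  exists x, Depth n (subtree T (rcons s x)).
Proof.
move=> /DepthP[[//|x t] [szt] Tt]; exists x; apply/DepthP; exists t => //.
by rewrite /subtree cat_rcons.
Qed.

End Trees.

Section ErdosRadoTree.
Variables (c : nat -> nat -> bool) (beta : nat -> nat).
Hypothesis beta_bound : forall (n k : nat) (s : n.-tuple bool),
  ERbranch c s k -> ERbranch c s (beta n).

Lemma ERbranch_tree s k : ERbranch c s k -> ERtree c beta s.
Proof. exact: (beta_bound _ _ (in_tuple s)). Qed.

(** The witness for [s ++ t] also serves [s], but only below [beta (size (s ++ t))]; [beta_bound]
    brings a witness below [beta (size s)]. *)
Lemma ERtree_prefix s t : ERtree c beta (s ++ t) -> ERtree c beta s.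
Proof.
move=> /existsP[k /andP[sz /forallP st]].
apply: (@ERbranch_tree _ (beta (size (s ++ t)))).
have le_s : size s <= size (s ++ t) by rewrite size_cat leq_addr.
apply/existsP; exists k; rewrite (leq_trans le_s sz) /=; apply/forallP => i.
by have := st (widen_ord le_s i); rewrite /= nth_cat ltn_ord.
Qed.

Lemma ERtree_Depth n : Depth n (subtree (ERtree c beta) [::]).
Proof.
(* This is the branch of predecessors of [n], with [n] itself as the witness; the negation is there
   because entry 0 encodes precedence. *)
apply/DepthP; exists (mkseq (fun i => ~~ ERlt c i n) n).
  by rewrite size_mkseq.
apply: (@ERbranch_tree _ n); apply/existsP; exists ord_max.
rewrite size_mkseq leqnn /=; apply/forallP => i.
by rewrite nth_mkseq // eqbF_neg negbK.
Qed.

Lemma ERsel_Depth s p : let x := ERsel c beta s p in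
  Depth (p x).+1 (subtree (ERtree c beta) s) ->
  Depth (p x) (subtree (ERtree c beta) (rcons s x)).
Proof.
rewrite /ERsel /= addn1; case: ifP => [/implyP //|/negbT].
rewrite negb_imply => /andP[D0 nD0] D1.
have D_le := Depth_subtree_le _ ERtree_prefix.
(* Here [true] was chosen, so the [false] child lacks depth [p false]. If [p true <= p false], the
   child given by [D0] is the [true] one and is deep enough. Otherwise the child given by [D1] must
   be [true], since a [false] child of depth [p true] would also have depth [p false]. *)
have [le10|/ltnW le01] := leqP (p true) (p false).
  have [[D|nD]] := Depth_subtreeS _ _ _ D0; first exact: D_le le10 D.
  by rewrite nD in nD0.
have [[//|D]] := Depth_subtreeS _ _ _ D1.
by rewrite (D_le _ _ _ le01 D) in nD0.
Qed.

End ErdosRadoTree.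

Theorem theorem4p4 (c : nat -> nat -> bool)
  (c_sym : forall i j, c i j = c j i)
  (beta : nat -> nat)
  (beta_bound : forall (n k : nat) (s : n.-tuple bool),
     ERbranch c s k -> ERbranch c s (beta n))
  (omega : {ptws nat -> bool} -> nat) (comega : continuous omega) :
  let alpha := EPS false (ERsel c beta) comega [::] (q_omega c beta omega) in
  ERtree c beta (mkseq alpha (omega alpha)).
Proof.
cbv zeta; set alpha := EPS _ _ _ _ _; set m := omega alpha.
pose D n k := Depth n (subtree (ERtree c beta) (mkseq alpha k)).
have step k : k < m -> D (m - k) k -> D (m - k - 1) k.+1.
  pose fails k := ~~ (D (m - k) k ==> D (m - k - 1) k.+1).
  suff nofail : ~~ has fails (iota 0 m).
    move=> lt_km Dk; have /hasPn/(_ k) := nofail.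
    by rewrite mem_iota negbK Dk; apply.
  apply/negP => has_fails; pose j := find fails (iota 0 m).
  have lt_jm : j < m by rewrite -(size_iota 0 m) -has_find.
  have q_alpha : q_omega c beta omega alpha = m - j - 1.
    by rewrite /q_omega -/m -/D -/fails -/j lt_jm.
  have := nth_find 0 has_fails; rewrite nth_iota // -/j add0n => /negP; apply.
  have [p pj p_alpha] := EPS_spector _ _ _ _ comega _ _ _ (ltnW lt_jm).
  have := ERsel_Depth _ _ beta_bound (mkseq alpha j) p.
  (* As [j < m], the successor of [m - j - 1] is [m - j], so this becomes the very implication that
     [fails j] denies. *)
  rewrite /= -pj -mkseqS p_alpha q_alpha subn1 prednK ?subn_gt0 // => ?.
  exact/implyP.
suff Dm k : k <= m -> D (m - k) k.
  by have := Dm m (leqnn m); rewrite subnn /D Depth0 /subtree cats0.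
elim: k => [_|k IHk lt_km]; first exact: ERtree_Depth.
by rewrite subnS -subn1; apply: step => //; apply/IHk/ltnW.
Qed.
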